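(* Let $(t^*,\lambda^* )$ be an optimal solution of the problem $$\max_{t\in\mathbb{R},\ \lambda\ge 0}\ k(t,\lambda)=(\Delta+1)\lambda_{\min}(D(t,\lambda))-t-\lambda c .$$ Then the following hold. 1. Suppose $\lambda_{\min}(D(t^*,\lambda^* ))<\lambda_{\min}(A)$ and let $y=[y_0,\ z^T]^T$ (with $y_0\in\mathbb{R}$, $z\in\mathbb{R}^n$) be a normalized eigenvector of $D(t^*,\lambda^* )$ for $\lambda_{\min}(D(t^*,\lambda^* ))$. Then strong duality holds for eTRS and $x^*=z/y_0$ is a global optimal solution of eTRS. 2. Suppose $\lambda_{\min}(D(t^*,\lambda^* ))=\lambda_{\min}(A)$ and let $y=[y_0,\ z_0^T]^T$ (with $y_0\in\mathbb{R}$, $z_0\in\mathbb{R}^n$) be a normalized eigenvector of $D(t^*,\lambda^* )$ for $\lambda_{\min}(D(t^*,\lambda^* ))$ with $y_0\neq 0$. Then: 2.1. If $\lambda_{\min}(A)<0$ has multiplicity one, $\lambda^*>0$, and the linear system $(A-\lambda_{\min}(A)I)x=a-\frac{\lambda^*}{2}b$ has two solutions $x_1$ and $x_2$ satisfying $x_i^Tx_i=\Delta$ for $i=1,2$ and $(b^Tx_1-c)(b^Tx_2-c)<0$, then strong duality does not hold for eTRS. 2.2. Otherwise (i.e. if the conditions in 2.1 do not all hold), strong duality holds for eTRS and there exists a vector $z$ in the eigenspace $\mathrm{Null}(A-\lambda_{\min}(A)I)$ such that $x^*=\frac{z_0}{y_0}+z$ is a global optimal solution of eTRS.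
   Context: Let $A\in\mathbb{R}^{n\times n}$ be symmetric and not positive definite, $a,b\in\mathbb{R}^n$, $c,\Delta\in\mathbb{R}$ with $\Delta>0$. The extended trust region subproblem (eTRS) is $$p^*:=\min\ x^TAx-2a^Tx\quad\text{subject to}\quad \|x\|^2\le\Delta,\ \ b^Tx\le c .$$ Standing assumption (Slater condition): there is $\hat x\in\mathbb{R}^n$ with $\|\hat x\|^2<\Delta$ and $b^T\hat x<c$. The norm is the Euclidean norm, and $\lambda_{\min}(S)$ denotes the smallest eigenvalue of a symmetric matrix $S$; ''normalized'' means of Euclidean norm $1$. For $t,\lambda\in\mathbb{R}$, $$D(t,\lambda)=\begin{bmatrix} t & (-a+\frac{\lambda}{2}b)^T\\ -a+\frac{\lambda}{2}b & A\end{bmatrix}\in\mathbb{R}^{(n+1)\times(n+1)} .$$ The Lagrangian dual value of eTRS is $$d^*:=\max_{\lambda_1,\lambda_2\ge0}\ \min_{x\in\mathbb{R}^n}\ x^TAx-2a^Tx+\lambda_1(\|x\|^2-\Delta)+\lambda_2(b^Tx-c),$$ and strong duality holds for eTRS if $p^*=d^*$. *)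

(* Defs.v *)
From HB Require Import structures.
From mathcomp Require Import all_boot all_order all_algebra.
From mathcomp Require Import all_classical all_reals all_analysis.

Set Implicit Arguments.
Unset Strict Implicit.
Unset Printing Implicit Defensive.

Import Order.TTheory GRing.Theory Num.Theory.

Local Open Scope classical_set_scope.
Local Open Scope ring_scope.

Definition dotv (R : realType) (n : nat) (u v : 'cV[R]_n) : R :=
  (u^T *m v) 0 0.

(* The library norm [`|x|] on matrices is the sup norm, hence this one. *)
Definition enorm (R : realType) (n : nat) (x : 'cV[R]_n) : R :=
  Num.sqrt (dotv x x).

Definition posdef (R : realType) (n : nat) (A : 'M[R]_n) : Prop :=
  forall x : 'cV[R]_n, x != 0 -> 0 < dotv x (A *m x).

(* For a symmetric matrix of positive size the set of eigenvalues is finite and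
   nonempty, so that the infimum is a minimum. *)
Definition lambda_min (R : realType) (n : nat) (S : 'M[R]_n) : R :=
  inf [set l : R | eigenvalue S l].

(* The library predicate [eigenvalue] is about row vectors; eigenvectors are
   columns here, which is the same thing for the symmetric matrices at hand. *)
Definition normalized_eigenvector (R : realType) (n : nat) (S : 'M[R]_n)
    (l : R) (y : 'cV[R]_n) : Prop :=
  S *m y = l *: y /\ enorm y = 1.

Definition objective (R : realType) (n : nat) (A : 'M[R]_n) (a x : 'cV[R]_n)
    : R :=
  dotv x (A *m x) - 2 * dotv a x.

Definition feasible (R : realType) (n : nat) (b : 'cV[R]_n) (c Delta : R)
    : set 'cV[R]_n :=
  [set x | enorm x ^+ 2 <= Delta /\ dotv b x <= c].

Definition global_solution (R : realType) (n : nat) (A : 'M[R]_n)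
    (a b : 'cV[R]_n) (c Delta : R) (x : 'cV[R]_n) : Prop :=
  feasible b c Delta x /\
  forall x' : 'cV[R]_n, feasible b c Delta x' ->
    objective A a x <= objective A a x'.

Definition slater (R : realType) (n : nat) (b : 'cV[R]_n) (c Delta : R)
    : Prop :=
  exists x : 'cV[R]_n, enorm x ^+ 2 < Delta /\ dotv b x < c.

Definition primal_value (R : realType) (n : nat) (A : 'M[R]_n)
    (a b : 'cV[R]_n) (c Delta : R) : \bar R :=
  ereal_inf [set (objective A a x)%:E | x in feasible b c Delta].

Definition lagrangian (R : realType) (n : nat) (A : 'M[R]_n)
    (a b : 'cV[R]_n) (c Delta : R) (l1 l2 : R) (x : 'cV[R]_n) : R :=
  objective A a x + l1 * (enorm x ^+ 2 - Delta) + l2 * (dotv b x - c).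

(* The inner minimum may be -oo, hence the extended reals. *)
Definition dual_value (R : realType) (n : nat) (A : 'M[R]_n)
    (a b : 'cV[R]_n) (c Delta : R) : \bar R :=
  ereal_sup
    [set ereal_inf [set (lagrangian A a b c Delta l.1 l.2 x)%:E
                   | x in [set: 'cV[R]_n]]
    | l in [set l : R * R | 0 <= l.1 /\ 0 <= l.2]].

Definition strong_duality (R : realType) (n : nat) (A : 'M[R]_n)
    (a b : 'cV[R]_n) (c Delta : R) : Prop :=
  primal_value A a b c Delta = dual_value A a b c Delta.

Definition Dmx (R : realType) (n : nat) (A : 'M[R]_n) (a b : 'cV[R]_n)
    (t l : R) : 'M[R]_(1 + n) :=
  block_mx t%:M (- a + (l / 2) *: b)^T
           (- a + (l / 2) *: b) A.

Definition kfun (R : realType) (n : nat) (A : 'M[R]_n) (a b : 'cV[R]_n)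
    (c Delta : R) (t l : R) : R :=
  (Delta + 1) * lambda_min (Dmx A a b t l) - t - l * c.

Definition k_optimal (R : realType) (n : nat) (A : 'M[R]_n) (a b : 'cV[R]_n)
    (c Delta : R) (t l : R) : Prop :=
  0 <= l /\
  forall t' l' : R, 0 <= l' ->
    kfun A a b c Delta t' l' <= kfun A a b c Delta t l.

Definition mxcons (R : realType) (n : nat) (y0 : R) (z : 'cV[R]_n)
    : 'cV[R]_(1 + n) :=
  col_mx y0%:M z.

(* Multiplicity is the dimension of the eigenspace; for a symmetric matrix it is
   also the multiplicity as a root of the characteristic polynomial. *)
Definition duality_gap_conditions (R : realType) (n : nat) (A : 'M[R]_n)
    (a b : 'cV[R]_n) (c Delta : R) (l : R) : Prop :=
  [/\ lambda_min A < 0,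
      \rank (eigenspace A (lambda_min A)) = 1%N,
      0 < l &
      exists x1 x2 : 'cV[R]_n,
        [/\ (A - (lambda_min A)%:M) *m x1 = a - (l / 2) *: b,
            (A - (lambda_min A)%:M) *m x2 = a - (l / 2) *: b,
            dotv x1 x1 = Delta,
            dotv x2 x2 = Delta &
            (dotv b x1 - c) * (dotv b x2 - c) < 0]].

(* Main.v *)
Require Import Defs.
From HB Require Import structures.
From mathcomp Require Import all_boot all_order all_algebra.
From mathcomp Require Import all_classical all_reals all_analysis.
From mathcomp Require Import ring lra.

Import Order.TTheory GRing.Theory Num.Theory.
Import numFieldNormedType.Exports.

Set Implicit Arguments.
Unset Strict Implicit.
Unset Printing Implicit Defensive.

Local Open Scope classical_set_scope.
Local Open Scope ring_scope.

(** The eigenvalue problem is the Lagrangian dual in disguise.  Put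
    [l1 = - lambda_min (D (t, l))].  The matrix [D (t, l) + l1 I] is the
    homogenization of the quadratic [L (x; l1, l) - const], so that its
    positive semidefiniteness says that the Lagrangian with multipliers
    [(l1, l)] is bounded below by [k (t, l)]; conversely, for every lower
    bound [m] of a Lagrangian some [t] has [k (t, l) >= m].  Hence an optimal
    [(t, l)] gives a maximizer of the dual function over [R x R+]
    (k_optimal_dual_maximal).  The sign of [l1] is not a constraint there, but
    at the optimum [l1 >= - lambda_min A >= 0] in the cases at hand, because
    [A] is not positive definite.  From then on only [Q = A + l1 I], which is
    positive semidefinite, and the stationarity equation [Q x = a - (l/2) b]
    matter; the eigenvector [(y0, z)] provides the solution [z / y0].

    The main step (dual_maximal_KKT) is that dual optimality yields a feasible
    stationary point with complementary slackness for the linear constraint.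
    Among the stationary points, which form a translate of [ker Q], let [xp] be
    the one orthogonal to [ker Q].  Perturbing the multipliers to
    [(l1 + s, l + s q)] with a small [s > 0] changes the dual value by
    [- s (rho + q gamma + q^2 |bN|^2 / 4)] up to [O (s^2)], where
    [rho = Delta - |xp|^2], [gamma = c - b.xp] and [bN] is the component of [b]
    in [ker Q].  Optimality makes the bracket nonnegative for all admissible
    [q], a discriminant condition which says exactly that a suitable
    [xp + t bN] satisfies the constraints.

    A feasible stationary point satisfying complementary slackness for both
    constraints is optimal and closes the gap (stationary_solution), so what is
    left is to reach the sphere when [l1 > 0].  If
    [lambda_min D < lambda_min A], then [Q] is positive definite, the
    stationary point is unique, and decreasing [l1] as well shows that it lies
    on the sphere (dual_maximal_boundary).  If
    [lambda_min D = lambda_min A < 0], then [ker Q] is a nonzero eigenspace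
    along which one moves from the feasible stationary point to the sphere
    (no_duality_gap).  This preserves the linear constraint with its slackness
    if [l = 0], where one picks the right sign, or if the direction is
    orthogonal to [b].  The remaining case is that of a line not orthogonal to
    [b] and [l > 0]; then either the point is already on the sphere, or the
    two exit points lie strictly on opposite sides of the hyperplane, and these
    are the conditions of the gap.  Under these conditions there is indeed a
    gap (duality_gap), since a primal minimizer would have to be one of the two
    exit points while lying on the hyperplane. *)

(** * Euclidean inner product *)

Lemma dotvE (R : realType) (n : nat) (u v : 'cV[R]_n) :
  dotv u v = \sum_i u i 0 * v i 0.
Proof. by rewrite /dotv mxE; apply: eq_bigr => i _; rewrite mxE. Qed.

Lemma dotvC (R : realType) (n : nat) (u v : 'cV[R]_n) : dotv u v = dotv v u.
Proof. by rewrite !dotvE; apply: eq_bigr => i _; rewrite mulrC. Qed.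

Lemma dotvDl (R : realType) (n : nat) (u v w : 'cV[R]_n) :
  dotv (u + v) w = dotv u w + dotv v w.
Proof. by rewrite /dotv linearD mulmxDl mxE. Qed.

Lemma dotvDr (R : realType) (n : nat) (u v w : 'cV[R]_n) :
  dotv w (u + v) = dotv w u + dotv w v.
Proof. by rewrite /dotv mulmxDr mxE. Qed.

Lemma dotvZl (R : realType) (n : nat) (k : R) (u v : 'cV[R]_n) :
  dotv (k *: u) v = k * dotv u v.
Proof. by rewrite /dotv linearZ /= -scalemxAl mxE. Qed.

Lemma dotvZr (R : realType) (n : nat) (k : R) (u v : 'cV[R]_n) :
  dotv u (k *: v) = k * dotv u v.
Proof. by rewrite dotvC dotvZl dotvC. Qed.

Lemma dotvNl (R : realType) (n : nat) (u v : 'cV[R]_n) :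
  dotv (- u) v = - dotv u v.
Proof. by rewrite -scaleN1r dotvZl mulN1r. Qed.

Lemma dotvNr (R : realType) (n : nat) (u v : 'cV[R]_n) :
  dotv u (- v) = - dotv u v.
Proof. by rewrite dotvC dotvNl dotvC. Qed.

Lemma dotv0l (R : realType) (n : nat) (u : 'cV[R]_n) : dotv 0 u = 0.
Proof. by rewrite /dotv trmx0 mul0mx mxE. Qed.

Lemma dotv0r (R : realType) (n : nat) (u : 'cV[R]_n) : dotv u 0 = 0.
Proof. by rewrite dotvC dotv0l. Qed.

Definition dotv_lin := (dotvDl, dotvDr, dotvZl, dotvZr, dotvNl, dotvNr).

Lemma dotv_ge0 (R : realType) (n : nat) (u : 'cV[R]_n) : 0 <= dotv u u.
Proof. by rewrite dotvE; apply: sumr_ge0 => i _; rewrite -expr2 sqr_ge0. Qed.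

Lemma dotv_eq0 (R : realType) (n : nat) (u : 'cV[R]_n) :
  (dotv u u == 0) = (u == 0).
Proof.
apply/idP/eqP => [|->]; last by rewrite dotv0l.
rewrite dotvE psumr_eq0 => [/allP u0|i _]; last by rewrite -expr2 sqr_ge0.
apply/colP => i; rewrite mxE; apply/eqP.
by have := u0 i (mem_index_enum i); rewrite -expr2 sqrf_eq0.
Qed.

Lemma dotv_gt0 (R : realType) (n : nat) (u : 'cV[R]_n) :
  (0 < dotv u u) = (u != 0).
Proof. by rewrite lt_def dotv_ge0 andbT dotv_eq0. Qed.

Lemma dotv_coord (R : realType) (n : nat) (u : 'cV[R]_n) (i : 'I_n) :
  u i 0 ^+ 2 <= dotv u u.
Proof.
rewrite dotvE (bigD1 i) //= -expr2 lerDl.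
by apply: sumr_ge0 => j _; rewrite -expr2 sqr_ge0.
Qed.

Lemma enorm_sqr (R : realType) (n : nat) (u : 'cV[R]_n) :
  enorm u ^+ 2 = dotv u u.
Proof. by rewrite /enorm sqr_sqrtr ?dotv_ge0. Qed.

Lemma symmetricmx_tr (R : realType) (n : nat) (S : 'M[R]_n) :
  (S \is symmetricmx) = (S^T == S).
Proof. by rewrite is_hermitianmxE expr0 scale1r map_mx_id // eq_sym. Qed.

Lemma dotv_sym (R : realType) (n : nat) (S : 'M[R]_n) (u v : 'cV[R]_n) :
  S \is symmetricmx -> dotv u (S *m v) = dotv v (S *m u).
Proof.
rewrite symmetricmx_tr => /eqP S_sym.
by rewrite [RHS]dotvC /dotv trmx_mul S_sym mulmxA.
Qed.

Lemma symmetricmx_shift (R : realType) (n : nat) (S : 'M[R]_n) (l : R) :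
  S \is symmetricmx -> S + l%:M \is symmetricmx.
Proof.
by rewrite !symmetricmx_tr linearD /= tr_scalar_mx => /eqP ->.
Qed.

Lemma dotv_shift (R : realType) (n : nat) (S : 'M[R]_n) (l : R)
    (u v : 'cV[R]_n) :
  dotv u ((S + l%:M) *m v) = dotv u (S *m v) + l * dotv u v.
Proof. by rewrite mulmxDl mul_scalar_mx dotvDr dotvZr. Qed.

Lemma sub_scalar_mx (R : realType) (n : nat) (S : 'M[R]_n) (l : R) :
  S - l%:M = S + (- l)%:M.
Proof. by apply/matrixP => i j; rewrite !mxE mulNrn. Qed.

(** * Existence of minimizers *)

Lemma trmx_continuous (R : realType) (m n : nat) :
  continuous (trmx : 'M[R]_(m, n) -> 'M[R]_(n, m)).
Proof.
move=> M s /nbhs_ballP[e e0 es]; apply/nbhs_ballP; exists e => //= N [_ MN].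
by apply: es; split => // i j; rewrite !mxE; exact: MN.
Qed.

Lemma dotv_continuous (R : realType) (n : nat) (f g : 'cV[R]_n -> 'cV[R]_n) :
  (forall i, continuous (fun x => f x i 0)) ->
  (forall i, continuous (fun x => g x i 0)) ->
  continuous (fun x => dotv (f x) (g x)).
Proof.
move=> cf cg.
under eq_fun do rewrite dotvE.
apply: continuous_big => [|i _]; first exact: add_continuous.
by move=> x; apply: (cvgM (cf i x) (cg i x)).
Qed.

Lemma mulmx_coord_continuous (R : realType) (n : nat) (S : 'M[R]_n) (i : 'I_n) :
  continuous (fun x : 'cV[R]_n => (S *m x) i 0).
Proof.
under eq_fun do rewrite mxE.
apply: continuous_big => [|j _]; first exact: add_continuous.
by move=> x; apply: (cvgM (cvg_cst _) (@coord_continuous _ _ _ j 0 x)).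
Qed.

Lemma quadratic_continuous (R : realType) (n : nat) (S : 'M[R]_n)
    (u : 'cV[R]_n) :
  continuous (fun x => dotv x (S *m x) - 2 * dotv u x).
Proof.
have cq : continuous (fun x => dotv x (S *m x)).
  apply: dotv_continuous => i; first exact: coord_continuous.
  exact: mulmx_coord_continuous.
have cl : continuous (fun x => dotv u x).
  by apply: dotv_continuous => i; [exact: cst_continuous | exact: coord_continuous].
by move=> x; apply: (cvgB (cq x) (cvgM (cvg_cst _) (cl x))).
Qed.

(** The library knows that bounded closed sets of row vectors are compact;
    transposition transfers this to columns. *)
Lemma bounded_closed_EVT_min (R : realType) (n : nat) (f : 'cV[R]_n -> R)
    (K : set 'cV[R]_n) (M : R) :
  K !=set0 -> closed K -> (forall x, K x -> dotv x x <= M) -> continuous f ->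
  exists2 x, K x & forall y, K y -> f x <= f y.
Proof.
move=> K0 clK bK cf.
have cptK : compact K.
  rewrite (_ : K = trmx @` [set v : 'rV[R]_n | K v^T]); last first.
    apply/seteqP; split => [x Kx | _ [v Kv <-]] //.
    by exists x^T; rewrite /= trmxK.
  apply: continuous_compact.
    exact/continuous_subspaceT/trmx_continuous.
  have cb : compact [set v : 'rV[R]_n |
      forall i, v ord0 i \in `[(- (M + 1)), (M + 1)]].
    apply: (@rV_compact _  _ (fun=> `[(- (M + 1)), (M + 1)]%classic)).
    by move=> _; apply: segment_compact.
  apply: subclosed_compact cb _.
    by apply: closed_comp => // v _; exact: trmx_continuous.
  move=> v /bK vM i; rewrite in_itv /=.
  have := le_trans (dotv_coord v^T i) vM; rewrite mxE => viM.
  by apply/andP; split; nra.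
have [x xK xmin] := compact_EVT_min K0 cptK (continuous_subspaceT cf).
by exists x => [|y Ky]; [rewrite inE in xK | apply: xmin; rewrite inE].
Qed.

(** * Positive semidefinite matrices *)

Definition possemidef (R : realType) (n : nat) (Q : 'M[R]_n) : Prop :=
  forall x : 'cV[R]_n, 0 <= dotv x (Q *m x).

Lemma quadratic_lead_ge0 (R : realType) (p q r : R) :
  (forall k, 0 <= p * k ^+ 2 + q * k + r) -> 0 <= p.
Proof.
move=> pos; rewrite leNgt; apply/negP => p0.
(* beyond this point the leading term dominates the other two *)
pose k := (`|q| + `|r| + 1) / - p + 1.
have := pos k.
have kE : p * k = - (`|q| + `|r| + 1) + p by rewrite /k; field; rewrite lt_eqF.
have k1 : 1 <= k.
  by rewrite lerDr divr_ge0 ?oppr_ge0 ?(ltW p0) // !addr_ge0.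
rewrite expr2 mulrA kE.
have := ler_norm q; have := ler_norm r.
have := normr_ge0 q; have := normr_ge0 r.
move: (`|q|) (`|r|) => q' r'; nra.
Qed.

(** The minimum over [k], at [k = - q / p], is [r - q ^+ 2 / p]. *)
Lemma quadratic_discr (R : realType) (p q r : R) :
  (forall k, 0 <= p * k ^+ 2 + 2 * q * k + r) -> q ^+ 2 <= p * r.
Proof.
move=> pos; have p0 := quadratic_lead_ge0 pos.
have [p_eq0|p_neq0] := eqVneq p 0.
  have [->|q_neq0] := eqVneq q 0; first by rewrite p_eq0 mul0r expr0n.
  have := pos (- (r + 1) / (2 * q)).
  rewrite p_eq0 mul0r add0r (_ : 2 * q * _ = - (r + 1)); first lra.
  by field; rewrite q_neq0.
have := pos (- q / p).
rewrite (_ : p * _ + _ + r = (p * r - q ^+ 2) / p); last by field.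
by rewrite pmulr_lge0 ?invr_gt0 ?lt_def ?p_neq0 // subr_ge0.
Qed.

Lemma possemidef_cauchy_schwarz (R : realType) (n : nat) (Q : 'M[R]_n)
    (x y : 'cV[R]_n) :
  Q \is symmetricmx -> possemidef Q ->
  dotv x (Q *m y) ^+ 2 <= dotv x (Q *m x) * dotv y (Q *m y).
Proof.
move=> Q_sym Q_psd; apply: quadratic_discr => k.
have := Q_psd (k *: x + y).
rewrite mulmxDr -scalemxAr !dotv_lin (dotv_sym y x Q_sym).
by congr (0 <= _); ring.
Qed.

Lemma quadratic_form_bounded (R : realType) (n : nat) (Q : 'M[R]_n) :
  exists2 C, 0 < C & forall x, dotv x (Q *m x) <= C * dotv x x.
Proof.
exists (1 + \sum_i \sum_j `|Q i j|).
  by rewrite ltr_wpDr ?ltr01 // sumr_ge0 // => i _; rewrite sumr_ge0.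
move=> x; rewrite [leLHS]dotvE mulrDl mul1r.
apply: ler_wpDl; first exact: dotv_ge0.
rewrite mulr_suml; apply: ler_sum => i _.
rewrite mxE mulr_sumr mulr_suml; apply: ler_sum => j _.
rewrite mulrCA; apply: (le_trans (ler_norm _)).
rewrite normrM ler_wpM2l //.
have := dotv_coord x i; have := dotv_coord x j.
by rewrite ler_norml => xi xj; apply/andP; split; nra.
Qed.

(** A positive semidefinite form controls the component of its argument
    outside the kernel.  The image vector measures that component, which
    makes an orthogonal complement unnecessary: the inequality is
    Cauchy-Schwarz for the form at [x] and [Q x]. *)
Lemma possemidef_gap (R : realType) (n : nat) (Q : 'M[R]_n) :
  Q \is symmetricmx -> possemidef Q ->
  exists2 C, 0 < C &
    forall x, dotv (Q *m x) (Q *m x) <= C * dotv x (Q *m x).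
Proof.
move=> Q_sym Q_psd; have [C C0 bC] := quadratic_form_bounded Q.
exists C => // x; set w := Q *m x.
have [w0|w_neq0] := eqVneq w 0; first by rewrite w0 !dotv0r mulr0.
have := possemidef_cauchy_schwarz w x Q_sym Q_psd.
have := bC w; have := Q_psd x.
have : 0 < dotv w w by rewrite dotv_gt0.
rewrite -/w; move: (dotv w w) (dotv w (Q *m w)) (dotv x w) => p q r p0 r0 qp.
by move=> pqr; rewrite -(ler_pM2l p0); nra.
Qed.

Lemma possemidef_ker (R : realType) (n : nat) (Q : 'M[R]_n) (x : 'cV[R]_n) :
  Q \is symmetricmx -> possemidef Q -> dotv x (Q *m x) = 0 -> Q *m x = 0.
Proof.
move=> Q_sym Q_psd xQx; have [C _ gap] := possemidef_gap Q_sym Q_psd.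
apply/eqP; rewrite -dotv_eq0 eq_le dotv_ge0 andbT.
by have := gap x; rewrite xQx mulr0.
Qed.

(** For symmetric [Q] a vector of the image that lies in the kernel is
    orthogonal to itself, so kernel and image are in direct sum and their
    dimensions add up to [n]. *)
Lemma symmetric_ker_im (R : realType) (n : nat) (Q : 'M[R]_n)
    (h : 'cV[R]_n) :
  Q \is symmetricmx -> exists k e : 'cV[R]_n, h = k + Q *m e /\ Q *m k = 0.
Proof.
rewrite symmetricmx_tr => /eqP QT.
have dis : (kermx Q :&: Q)%MS = 0.
  apply/eqP; rewrite -submx0; apply/rV_subP => v.
  rewrite sub_capmx => /andP[/sub_kermxP vQ /submxP[w vE]].
  rewrite submx0 -trmx_eq0 -dotv_eq0 dotvE.
  have : (v *m v^T) 0 0 = 0.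
    by rewrite {2}vE trmx_mul QT mulmxA vQ mul0mx mxE.
  by rewrite mxE => vv; apply/eqP; rewrite -[RHS]vv;
    apply: eq_bigr => i _; rewrite !mxE.
have full : row_full (kermx Q + Q)%MS.
  by rewrite /row_full mxrank_disjoint_sum // mxrank_ker subnK ?rank_leq_row.
have /sub_addsmxP[[u v] hE] := submx_full h^T full.
exists (u *m kermx Q)^T, v^T; split.
  by rewrite -[LHS]trmxK hE /= linearD /= !trmx_mul QT.
by rewrite -{1}QT -trmx_mul -mulmxA mulmx_ker mulmx0 trmx0.
Qed.

(** * The smallest eigenvalue *)

Lemma eigenvalue_colP (R : realType) (n : nat) (S : 'M[R]_n) (l : R) :
  S \is symmetricmx ->
  eigenvalue S l <-> exists2 v : 'cV[R]_n, S *m v = l *: v & v != 0.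
Proof.
rewrite symmetricmx_tr => /eqP ST; split => [/eigenvalueP[v vS v0]|[v Sv v0]].
  exists v^T; last by rewrite trmx_eq0.
  by rewrite -{1}ST -trmx_mul vS linearZ.
apply/eigenvalueP; exists v^T; last by rewrite trmx_eq0.
by rewrite -{1}ST -trmx_mul Sv linearZ.
Qed.

(** The minimum [m] of the quadratic form over the unit sphere is attained at
    some [v].  Then [S - m] is positive semidefinite and its form vanishes at
    [v], whence [S v = m v]; no eigenvalue is below [m]. *)
Lemma lambda_min_rayleigh (R : realType) (n : nat) (S : 'M[R]_n) :
  (0 < n)%N -> S \is symmetricmx ->
  eigenvalue S (lambda_min S) /\
    possemidef (S + (- lambda_min S)%:M).
Proof.
move=> n0 S_sym.
have [v v1 vmin] : exists2 v : 'cV[R]_n, dotv v v = 1 &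
    forall y, dotv y y = 1 -> dotv v (S *m v) <= dotv y (S *m y).
  have cdot : continuous (fun x : 'cV[R]_n => dotv x x).
    by apply: dotv_continuous => i; exact: coord_continuous.
  have [||||v v1 vmin] := @bounded_closed_EVT_min R n
      (fun x => dotv x (S *m x) - 2 * dotv 0 x)
      [set x | dotv x x = 1] 1.
  - exists (delta_mx (Ordinal n0) 0) => /=.
    rewrite dotvE (bigD1 (Ordinal n0)) //= big1 => [|i /negPf ni].
      by rewrite mxE !eqxx mulr1 addr0.
    by rewrite mxE ni mul0r.
  - apply: (@closed_comp _ _ (fun x : 'cV[R]_n => dotv x x) [set 1]).
      by move=> x _; exact: cdot.
    exact: closed_eq.
  - by move=> x /= ->.
  - exact: quadratic_continuous.
  by exists v => // y y1; have := vmin y y1; rewrite !dotv0l !mulr0 !subr0.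
set m := dotv v (S *m v) in vmin.
have S_psd : possemidef (S + (- m)%:M).
  move=> x; have [->|x_neq0] := eqVneq x 0; first by rewrite dotv0l.
  have x0 : 0 < dotv x x by rewrite dotv_gt0.
  have s0 : Num.sqrt (dotv x x) != 0 by rewrite gt_eqF ?sqrtr_gt0.
  have ss := sqr_sqrtr (ltW x0).
  have := vmin ((Num.sqrt (dotv x x))^-1 *: x).
  rewrite -scalemxAr !dotv_lin !mulrA -invfM -expr2 ss mulVf ?gt_eqF //.
  rewrite dotv_shift => /(_ erefl); rewrite mulrC ler_pdivlMr //; lra.
have v_neq0 : v != 0 by rewrite -dotv_gt0 v1 ltr01.
have Sv : (S + (- m)%:M) *m v = 0.
  apply: (possemidef_ker (symmetricmx_shift _ S_sym) S_psd).
  by rewrite dotv_shift v1 mulr1 subrr.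
have m_eig : eigenvalue S m.
  apply/eigenvalue_colP => //; exists v => //.
  by move/eqP: Sv; rewrite mulmxDl mul_scalar_mx scaleNr subr_eq0 => /eqP.
have m_lb : lbound [set l : R | eigenvalue S l] m.
  move=> l /= /(eigenvalue_colP _ S_sym)[w Sw w_neq0].
  have := S_psd w; rewrite dotv_shift Sw dotvZr -mulrDl.
  by rewrite pmulr_lge0 ?dotv_gt0 // subr_ge0.
suff -> : lambda_min S = m by [].
apply/eqP; rewrite eq_le; apply/andP; split.
  by apply: ge_inf m_eig; exists m.
by apply: lb_le_inf => //; exists m.
Qed.

Lemma lambda_min_le (R : realType) (n : nat) (S : 'M[R]_n) (x : 'cV[R]_n) :
  S \is symmetricmx -> lambda_min S * dotv x x <= dotv x (S *m x).
Proof.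
case: n S x => [|n] S x S_sym.
  by rewrite (flatmx0 x) !dotv0l mulr0.
have [_ /(_ x)] := lambda_min_rayleigh (ltn0Sn n) S_sym.
by rewrite dotv_shift mulNr subr_ge0.
Qed.

Lemma le_lambda_min (R : realType) (n : nat) (S : 'M[R]_n) (l : R) :
  (0 < n)%N -> S \is symmetricmx ->
  (forall x, l * dotv x x <= dotv x (S *m x)) -> l <= lambda_min S.
Proof.
move=> n0 S_sym lS; have [+ _] := lambda_min_rayleigh n0 S_sym.
move=> /(eigenvalue_colP _ S_sym)[w Sw w_neq0]; have := lS w.
by rewrite Sw dotvZr ler_pM2r // dotv_gt0.
Qed.

(** * Lagrangian duality *)

Lemma lagrangianE (R : realType) (n : nat) (A : 'M[R]_n) (a b : 'cV[R]_n)
    (c Delta l1 l2 : R) (x : 'cV[R]_n) :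
  lagrangian A a b c Delta l1 l2 x =
  dotv x ((A + l1%:M) *m x) - 2 * dotv (a - (l2 / 2) *: b) x
  - l1 * Delta - l2 * c.
Proof.
rewrite /lagrangian /objective enorm_sqr dotv_shift !dotv_lin; by field.
Qed.

(** A stationary point solves the first-order condition, so the expansion of
    the quadratic around it has no linear term. *)
Lemma lagrangian_stationary (R : realType) (n : nat) (A : 'M[R]_n)
    (a b : 'cV[R]_n) (c Delta l1 l2 : R) (x0 u : 'cV[R]_n) :
  A \is symmetricmx -> (A + l1%:M) *m x0 = a - (l2 / 2) *: b ->
  lagrangian A a b c Delta l1 l2 (x0 + u) =
  lagrangian A a b c Delta l1 l2 x0 + dotv u ((A + l1%:M) *m u).
Proof.
move=> /(symmetricmx_shift l1) Q_sym x0E.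
rewrite !lagrangianE -x0E; set Q := A + l1%:M in Q_sym *.
rewrite mulmxDr !dotv_lin (dotv_sym x0 u Q_sym) ![dotv (Q *m x0) _]dotvC.
ring.
Qed.

Lemma lagrangian_perturb (R : realType) (n : nat) (A : 'M[R]_n)
    (a b : 'cV[R]_n) (c Delta l1 l2 s1 s2 : R) (x : 'cV[R]_n) :
  lagrangian A a b c Delta (l1 + s1) (l2 + s2) x =
  lagrangian A a b c Delta l1 l2 x
  + s1 * (dotv x x - Delta) + s2 * (dotv b x - c).
Proof. by rewrite /lagrangian enorm_sqr; ring. Qed.

Lemma lagrangian_slack (R : realType) (n : nat) (A : 'M[R]_n)
    (a b : 'cV[R]_n) (c Delta l1 l2 : R) (x : 'cV[R]_n) :
  l1 * (dotv x x - Delta) = 0 -> l2 * (dotv b x - c) = 0 ->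
  lagrangian A a b c Delta l1 l2 x = objective A a x.
Proof. by rewrite /lagrangian enorm_sqr => -> ->; rewrite !addr0. Qed.

Lemma lagrangian_le_objective (R : realType) (n : nat) (A : 'M[R]_n)
    (a b : 'cV[R]_n) (c Delta l1 l2 : R) (x : 'cV[R]_n) :
  0 <= l1 -> 0 <= l2 -> feasible b c Delta x ->
  lagrangian A a b c Delta l1 l2 x <= objective A a x.
Proof. by move=> l1_ge0 l2_ge0 [xD xc]; rewrite /lagrangian; nra. Qed.

(** Global optimality and the absence of a duality gap come together: both
    follow by squeezing between the two values once the Lagrangian at some
    multipliers is bounded below by the objective at a feasible point. *)
Lemma lagrangian_certificate (R : realType) (n : nat) (A : 'M[R]_n)
    (a b : 'cV[R]_n) (c Delta l1 l2 : R) (x : 'cV[R]_n) :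
  0 <= l1 -> 0 <= l2 -> feasible b c Delta x ->
  (forall y, objective A a x <= lagrangian A a b c Delta l1 l2 y) ->
  strong_duality A a b c Delta /\ global_solution A a b c Delta x.
Proof.
move=> l1_ge0 l2_ge0 xF xL; split; last first.
  split=> // y yF; apply: (le_trans (xL y)).
  exact: lagrangian_le_objective.
apply/le_anti/andP; split.
  apply: (@le_trans _ _ (objective A a x)%:E).
    by apply: ereal_inf_lbound; exists x.
  apply: (@le_trans _ _ (ereal_inf
      [set (lagrangian A a b c Delta l1 l2 y)%:E | y in [set: 'cV[R]_n]])).
    by apply: le_ereal_inf_tmp => _ [y _ <-]; rewrite lee_fin.
  by apply: ereal_sup_ubound; exists (l1, l2).
apply: ge_ereal_sup => _ [[k1 k2] /= [k1_ge0 k2_ge0] <-].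
apply: le_ereal_inf_tmp => _ [y yF <-].
apply: (@le_trans _ _ (lagrangian A a b c Delta k1 k2 y)%:E).
  by apply: ereal_inf_lbound; exists y.
by rewrite lee_fin lagrangian_le_objective.
Qed.

(** The sign of the first multiplier is left free: the eigenvalue problem
    does not see that constraint, and perturbing in both directions is what
    gives the complementary slackness of the ball constraint. *)
Definition dual_maximal (R : realType) (n : nat) (A : 'M[R]_n)
    (a b : 'cV[R]_n) (c Delta l1 l2 : R) : Prop :=
  forall k1 k2 m : R, 0 <= k2 ->
    (forall x, m <= lagrangian A a b c Delta k1 k2 x) ->
    forall x, m <= lagrangian A a b c Delta l1 l2 x.

(** The first variation of the dual value in the direction [(1, q)].  At
    [xp + u] the perturbation by [s] adds [u.(Q u)] to terms of size [s]; those
    linear in the kernel part of [u] are absorbed by [s |u|^2] and cost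
    [s q^2 |bN|^2 / 4], and those linear in [Q u] are absorbed by [u.(Q u)]
    through the spectral gap and cost only [O (s^2)].  A negative right-hand
    side would make the dual value increase for small [s]. *)
Lemma dual_maximal_slack (R : realType) (n : nat) (A : 'M[R]_n)
    (a b : 'cV[R]_n) (c Delta l1 l2 q : R) (xp e0 bN e : 'cV[R]_n) :
  A \is symmetricmx -> possemidef (A + l1%:M) ->
  dual_maximal A a b c Delta l1 l2 ->
  0 <= l2 -> (0 < l2 \/ 0 <= q) ->
  (A + l1%:M) *m xp = a - (l2 / 2) *: b -> xp = (A + l1%:M) *m e0 ->
  b = bN + (A + l1%:M) *m e -> (A + l1%:M) *m bN = 0 ->
  0 <= Delta - dotv xp xp + q * (c - dotv b xp) + q ^+ 2 * dotv bN bN / 4.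
Proof.
move=> A_sym + maxL l2_ge0 q_adm.
have := symmetricmx_shift l1 A_sym.
set Q := A + l1%:M => Q_sym Q_psd xpE xp_im bE bN0.
have [C C0 gap] := possemidef_gap Q_sym Q_psd.
rewrite leNgt; apply/negP => neg.
set eta := (_ + _ + _) in neg; rewrite -oppr_gt0 in neg.
have [f fE] : {f | f = 2 *: e0 + q *: e} by exists (2 *: e0 + q *: e).
pose F := dotv f f.
have F0 : 0 <= F by exact: dotv_ge0.
have [s s0 [sl sF]] : exists2 s, 0 < s & 0 <= l2 + s * q /\ s * (C * F) < - eta.
  have CF1 : 0 < C * F + 1 by rewrite ltr_wpDl // mulr_ge0 // ltW.
  pose s := - eta / (C * F + 1).
  have s0 : 0 < s by rewrite divr_gt0.
  have sF : s * (C * F) < - eta.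
    by rewrite -mulrA gtr_pMr // mulrC ltr_pdivrMr // mul1r ltrDl.
  case: q_adm => [l2_gt0|q_ge0]; last first.
    by exists s => //; split => //; rewrite addr_ge0 // mulr_ge0 // ltW.
  have q1 : 0 < `|q| + 1 by rewrite ltr_wpDl.
  exists (Num.min s (l2 / (`|q| + 1))); first by rewrite lt_min s0 divr_gt0.
  split; last first.
    apply: le_lt_trans sF; rewrite ler_wpM2r ?mulr_ge0 ?(ltW C0) //.
    by rewrite ge_min lexx.
  set r := Num.min _ _.
  have r0 : 0 <= r by rewrite le_min !ltW ?divr_gt0.
  have : r * (`|q| + 1) <= l2 by rewrite -ler_pdivlMr // ge_min lexx orbT.
  have : - (r * `|q|) <= r * q.
    by rewrite -mulrN ler_wpM2l // lerNl -normrN ler_norm.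
  lra.
have lower u : lagrangian A a b c Delta l1 l2 xp + s * (- eta) - s ^+ 2 * C * F / 4
    <= lagrangian A a b c Delta (l1 + s) (l2 + s * q) (xp + u).
  rewrite lagrangian_perturb lagrangian_stationary // -/Q.
  have ker_part : 0 <= s * dotv (u + (q / 2) *: bN) (u + (q / 2) *: bN).
    by rewrite mulr_ge0 ?dotv_ge0 // ltW.
  have im_part : 0 <= dotv u (Q *m u) + s * dotv f (Q *m u) + s ^+ 2 * C * F / 4.
    rewrite -(pmulr_rge0 _ C0).
    have := dotv_ge0 (Q *m u + (s * C / 2) *: f).
    rewrite !dotv_lin [dotv (Q *m u) f]dotvC -/F; have := gap u.
    lra.
  have xpu : dotv xp u = dotv e0 (Q *m u) by rewrite dotvC xp_im; exact: dotv_sym.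
  have bu : dotv b u = dotv bN u + dotv e (Q *m u).
    by rewrite {1}bE dotvDl; congr (_ + _); rewrite dotvC; exact: dotv_sym.
  move: ker_part im_part; rewrite fE /eta !dotv_lin [dotv u xp]dotvC xpu bu.
  rewrite [dotv u bN]dotvC; lra.
have : 0 < s * (- eta - s * (C * F)) by rewrite mulr_gt0 // subr_gt0.
have : 0 <= s * (s * (C * F)) by rewrite !mulr_ge0 // ltW.
have all_lower x : lagrangian A a b c Delta l1 l2 xp + s * (- eta)
    - s ^+ 2 * C * F / 4 <= lagrangian A a b c Delta (l1 + s) (l2 + s * q) x.
  by rewrite -[x in leRHS](subrKC xp); exact: lower.
have := maxL _ _ _ sl all_lower xp; lra.
Qed.

(** Within the line [xp + t bN] the constraints ask for
    [t ^+ 2 * |bN|^2 <= rho] and [t * |bN|^2 = gamma] (or [<= gamma] when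
    [l2 = 0]), and dual_maximal_slack at [q = - 2 gamma / |bN|^2] says that
    this system is solvable.  If [bN = 0], a large [q] shows that the linear
    constraint already holds at [xp]. *)
Lemma dual_maximal_KKT (R : realType) (n : nat) (A : 'M[R]_n)
    (a b : 'cV[R]_n) (c Delta l1 l2 : R) (x0 : 'cV[R]_n) :
  A \is symmetricmx -> possemidef (A + l1%:M) ->
  dual_maximal A a b c Delta l1 l2 -> 0 <= l2 ->
  (A + l1%:M) *m x0 = a - (l2 / 2) *: b ->
  exists x, [/\ (A + l1%:M) *m x = a - (l2 / 2) *: b,
    dotv x x <= Delta, dotv b x <= c & l2 * (dotv b x - c) = 0].
Proof.
move=> A_sym Q_psd maxL l2_ge0 x0E.
have Q_sym := symmetricmx_shift l1 A_sym.
have [k0 [e0 [x0_dec k0_ker]]] := symmetric_ker_im x0 Q_sym.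
have [bN [e [b_dec bN_ker]]] := symmetric_ker_im b Q_sym.
have [xp xp_im] : {xp | xp = (A + l1%:M) *m e0}.
  by exists ((A + l1%:M) *m e0).
have xpE : (A + l1%:M) *m xp = a - (l2 / 2) *: b.
  by rewrite -x0E x0_dec mulmxDr k0_ker add0r xp_im.
have slack q q_adm := dual_maximal_slack (q := q) A_sym Q_psd maxL l2_ge0 q_adm
  xpE xp_im b_dec bN_ker.
have rho_ge0 : 0 <= Delta - dotv xp xp.
  by have := slack 0 (or_intror (lexx 0)); rewrite expr0n !mul0r !addr0.
have xp_bN : dotv xp bN = 0.
  by rewrite xp_im dotvC (dotv_sym _ _ Q_sym) bN_ker dotv0r.
have b_bN : dotv b bN = dotv bN bN.
  rewrite {1}b_dec dotvDl [X in _ + X]dotvC (dotv_sym _ _ Q_sym) bN_ker.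
  by rewrite dotv0r addr0.
have xpN t : (A + l1%:M) *m (xp + t *: bN) = a - (l2 / 2) *: b.
  by rewrite mulmxDr -scalemxAr bN_ker scaler0 addr0.
have normN t : dotv (xp + t *: bN) (xp + t *: bN)
    = dotv xp xp + t ^+ 2 * dotv bN bN.
  by rewrite !dotv_lin [dotv bN xp]dotvC xp_bN; ring.
have bN_line t : dotv b (xp + t *: bN) = dotv b xp + t * dotv bN bN.
  by rewrite !dotv_lin b_bN.
have := dotv_ge0 bN; move: slack b_bN normN bN_line.
move: (dotv bN bN) => B slack b_bN normN bN_line B_ge0.
suff [t [tD tc tsl]] : exists t, [/\ dotv xp xp + t ^+ 2 * B <= Delta,
    dotv b xp + t * B <= c & l2 * (dotv b xp + t * B - c) = 0].
  by exists (xp + t *: bN); rewrite xpN normN bN_line.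
move: rho_ge0 slack; move: (dotv xp xp) (dotv b xp) => X beta rho_ge0 slack.
have [[l2_eq0 c_beta]|nondeg] : (l2 = 0 /\ beta <= c) \/ (0 < l2 \/ c < beta).
  have [cb|bc] := ltP c beta; first by right; right.
  move: l2_ge0; rewrite le_eqVlt => /orP[/eqP <-|]; last by right; left.
  by left.
  by exists 0; rewrite expr0n !mul0r !addr0 l2_eq0 mul0r; split => //; lra.
(* q = - k (c - beta) is an admissible direction: it is nonnegative when
   beta > c, which is the only way to have l2 = 0 here *)
have slack_neg k : 0 <= k -> 0 <= Delta - X - k * (c - beta) ^+ 2
    + k ^+ 2 * (c - beta) ^+ 2 * B / 4.
  move=> k_ge0; have := slack (- k * (c - beta)).
  have -> : - k * (c - beta) * (c - beta) = - (k * (c - beta) ^+ 2) by ring.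
  have -> : (- k * (c - beta)) ^+ 2 = k ^+ 2 * (c - beta) ^+ 2 by ring.
  apply; case: nondeg => [?|cb]; [by left|right].
  by rewrite mulNr -mulrN mulr_ge0 // opprB subr_ge0 ltW.
have [B_eq0|B_neq0] := eqVneq B 0.
  have [c_eq|c_neq] := eqVneq (c - beta) 0.
    by exists 0; rewrite B_eq0 !mulr0 !addr0 -opprB c_eq oppr0 mulr0;
      split => //; lra.
  have g0 : 0 < (c - beta) ^+ 2 by rewrite lt_def sqr_ge0 sqrf_eq0 c_neq.
  (* with bN = 0 the bound is affine in k, and this k makes it -1 *)
  have := slack_neg ((Delta - X + 1) / (c - beta) ^+ 2).
  rewrite B_eq0 mulr0 mul0r addr0 divfK ?gt_eqF // => H.
  by have := H (divr_ge0 (addr_ge0 rho_ge0 ler01) (ltW g0)); lra.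
have B0 : 0 < B by rewrite lt_def B_neq0.
exists ((c - beta) / B).
have -> : ((c - beta) / B) ^+ 2 * B = (c - beta) ^+ 2 / B by field.
rewrite divfK // (_ : beta + (c - beta) - c = 0); last by ring.
rewrite mulr0; split => //; last by lra.
have := slack_neg (2 / B) (divr_ge0 (ler0n _ _) B_ge0).
have -> : (2 / B) ^+ 2 * (c - beta) ^+ 2 * B / 4 = (c - beta) ^+ 2 / B by field.
have -> : 2 / B * (c - beta) ^+ 2 = 2 * ((c - beta) ^+ 2 / B) by field.
lra.
Qed.

(** Coercivity leaves room to decrease the first multiplier by a small [r],
    which adds [r (Delta - |x|^2)] to the dual value up to [O (r^2)]. *)
Lemma dual_maximal_boundary (R : realType) (n : nat) (A : 'M[R]_n)
    (a b : 'cV[R]_n) (c Delta l1 l2 k : R) (x : 'cV[R]_n) :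
  A \is symmetricmx -> 0 < k ->
  (forall u, k * dotv u u <= dotv u ((A + l1%:M) *m u)) ->
  dual_maximal A a b c Delta l1 l2 -> 0 <= l2 ->
  (A + l1%:M) *m x = a - (l2 / 2) *: b -> Delta <= dotv x x.
Proof.
move=> A_sym k0 coerc maxL l2_ge0 xE; rewrite leNgt; apply/negP => x_lt.
have X0 := dotv_ge0 x.
have D0 := le_lt_trans X0 x_lt.
have rho0 : 0 < Delta - dotv x x by rewrite subr_gt0.
(* half of the coercivity constant k pays for the quadratic term of the
   perturbation, the other half for the linear one *)
have [r rE] : {r | r = k * (Delta - dotv x x) / (2 * Delta)} by eexists.
have r0 : 0 < r by rewrite rE !(divr_gt0, mulr_gt0).
have rk : 2 * r <= k.
  have -> : 2 * r = k * ((Delta - dotv x x) / Delta).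
    by rewrite rE; field; rewrite gt_eqF.
  by rewrite ger_pMr // ler_pdivrMr // mul1r gerBl.
have rX : 2 * r / k * dotv x x < Delta - dotv x x.
  have -> : 2 * r / k * dotv x x = (Delta - dotv x x) * (dotv x x / Delta).
    by rewrite rE; field; rewrite !gt_eqF.
  by rewrite gtr_pMr // ltr_pdivrMr // mul1r.
have sl : 0 <= l2 + 0 by rewrite addr0.
have lower u : lagrangian A a b c Delta l1 l2 x
    + r * (Delta - dotv x x - 2 * r / k * dotv x x)
    <= lagrangian A a b c Delta (l1 + - r) (l2 + 0) (x + u).
  rewrite lagrangian_perturb lagrangian_stationary // mul0r addr0.
  have sq : 0 <= k / 2 * dotv (u - (2 * r / k) *: x) (u - (2 * r / k) *: x).
    by rewrite mulr_ge0 ?dotv_ge0 // divr_ge0 // ltW.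
  have kr : 0 <= (k / 2 - r) * dotv u u.
    by rewrite mulr_ge0 ?dotv_ge0 //; lra.
  have sqE : k / 2 * dotv (u - (2 * r / k) *: x) (u - (2 * r / k) *: x) =
      k / 2 * dotv u u - 2 * r * dotv x u + r * (2 * r / k * dotv x x).
    by rewrite !dotv_lin [dotv u x]dotvC; field; rewrite gt_eqF.
  have := coerc u; move: kr sq; rewrite sqE !dotv_lin [dotv u x]dotvC.
  move: (2 * r / k * _) => Z; lra.
have all_lower y : lagrangian A a b c Delta l1 l2 x
    + r * (Delta - dotv x x - 2 * r / k * dotv x x)
    <= lagrangian A a b c Delta (l1 + - r) (l2 + 0) y.
  by rewrite -[y in leRHS](subrKC x); exact: lower.
have := maxL _ _ _ sl all_lower x.
by apply/negP; rewrite -ltNge ltrDl mulr_gt0 // subr_gt0.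
Qed.

(** * The bordered matrix *)

Lemma dotv_mxcons (R : realType) (n : nat) (p q : R) (u v : 'cV[R]_n) :
  dotv (mxcons p u) (mxcons q v) = p * q + dotv u v.
Proof.
rewrite /dotv /mxcons tr_col_mx mul_row_col mxE tr_scalar_mx.
by rewrite -scalar_mxM mxE eqxx.
Qed.

Lemma mxcons_surj (R : realType) (n : nat) (y : 'cV[R]_(1 + n)) :
  y = mxcons (usubmx y 0 0) (dsubmx y).
Proof. by rewrite /mxcons -mx11_scalar vsubmxK. Qed.

Lemma mul_Dmx (R : realType) (n : nat) (A : 'M[R]_n) (a b : 'cV[R]_n)
    (t l p : R) (u : 'cV[R]_n) :
  Dmx A a b t l *m mxcons p u =
  mxcons (t * p + dotv (- a + (l / 2) *: b) u)
    (p *: (- a + (l / 2) *: b) + A *m u).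
Proof.
rewrite /Dmx /mxcons mul_block_col -scalar_mxM mul_mx_scalar.
by rewrite [X in col_mx (_ + X) _]mx11_scalar -raddfD.
Qed.

Lemma dotv_Dmx (R : realType) (n : nat) (A : 'M[R]_n) (a b : 'cV[R]_n)
    (t l p : R) (u : 'cV[R]_n) :
  dotv (mxcons p u) (Dmx A a b t l *m mxcons p u) =
  t * p ^+ 2 - 2 * p * dotv (a - (l / 2) *: b) u + dotv u (A *m u).
Proof.
rewrite mul_Dmx dotv_mxcons !dotv_lin [dotv u a]dotvC [dotv u b]dotvC; ring.
Qed.

Lemma Dmx_sym (R : realType) (n : nat) (A : 'M[R]_n) (a b : 'cV[R]_n)
    (t l : R) :
  A \is symmetricmx -> Dmx A a b t l \is symmetricmx.
Proof.
rewrite !symmetricmx_tr /Dmx tr_block_mx trmxK tr_scalar_mx => /eqP ->.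
exact: eqxx.
Qed.

Lemma normalized_eigenvector_mxcons (R : realType) (n : nat) (A : 'M[R]_n)
    (a b : 'cV[R]_n) (t l m p : R) (u : 'cV[R]_n) :
  normalized_eigenvector (Dmx A a b t l) m (mxcons p u) ->
  (A + (- m)%:M) *m u = p *: (a - (l / 2) *: b) /\ p ^+ 2 + dotv u u = 1.
Proof.
rewrite /normalized_eigenvector mul_Dmx => -[Dy y1]; split; last first.
  by rewrite -[RHS](expr1n _ 2) -y1 enorm_sqr dotv_mxcons expr2.
move: Dy; rewrite /mxcons scale_col_mx => /eq_col_mx[_ Au].
rewrite mulmxDl mul_scalar_mx scaleNr -Au opprD addrCA subrr addr0.
by rewrite -scalerN opprD opprK.
Qed.

(** Homogenization: for [p != 0] evaluate the bound at [u / p]; for [p = 0]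
    only the leading coefficient along the line [k u] survives. *)
Lemma lagrangian_bound_homogeneous (R : realType) (n : nat) (A : 'M[R]_n)
    (a b : 'cV[R]_n) (c Delta l1 l2 m p : R) (u : 'cV[R]_n) :
  (forall x, m <= lagrangian A a b c Delta l1 l2 x) ->
  0 <= dotv u ((A + l1%:M) *m u) - 2 * p * dotv (a - (l2 / 2) *: b) u
       - (l1 * Delta + l2 * c + m) * p ^+ 2.
Proof.
move=> mL; have [->|p_neq0] := eqVneq p 0.
  rewrite expr0n !mulr0 mul0r !subr0.
  apply: (@quadratic_lead_ge0 _ _ (- 2 * dotv (a - (l2 / 2) *: b) u)
    (- l1 * Delta - l2 * c - m)) => k.
  have := mL (k *: u); rewrite lagrangianE -scalemxAr dotvZr dotvZl dotvZr; lra.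
have := mL (p^-1 *: u).
rewrite lagrangianE -scalemxAr [dotv (_ *: u) _]dotvZl !dotvZr => mLp.
set w := dotv u _ in mLp *; set g := dotv _ u in mLp *.
have -> : w - 2 * p * g - (l1 * Delta + l2 * c + m) * p ^+ 2 =
  p ^+ 2 * (p^-1 * (p^-1 * w) - 2 * (p^-1 * g) - l1 * Delta - l2 * c - m).
  by field.
by rewrite mulr_ge0 ?sqr_ge0 // subr_ge0.
Qed.

(** Both directions of the correspondence between [kfun] and the dual
    function: a lower bound [m] at [(k1, k2)] becomes [m <= kfun t' k2] for the
    [t'] that makes [- k1] a lower bound of the form of [Dmx], and [kfun t l]
    is a lower bound of the Lagrangian by evaluating that form at [(1, x)]. *)
Lemma k_optimal_dual_maximal (R : realType) (n : nat) (A : 'M[R]_n)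
    (a b : 'cV[R]_n) (c Delta t l : R) :
  A \is symmetricmx -> 0 < Delta -> k_optimal A a b c Delta t l ->
  dual_maximal A a b c Delta (- lambda_min (Dmx A a b t l)) l.
Proof.
move=> A_sym D0 [l_ge0 kmax] k1 k2 m k2_ge0 mL x.
pose t' := - k1 - k1 * Delta - k2 * c - m.
have k1_le : - k1 <= lambda_min (Dmx A a b t' k2).
  apply: le_lambda_min => //; first exact: Dmx_sym.
  move=> y; rewrite (mxcons_surj y); move: (usubmx y 0 0) (dsubmx y) => p u.
  have := lagrangian_bound_homogeneous p u mL.
  by rewrite dotv_Dmx dotv_mxcons dotv_shift /t'; lra.
have D1 : 0 < Delta + 1 by rewrite addr_gt0.
have kE : m <= kfun A a b c Delta t' k2.
  have : (Delta + 1) * - k1 <= (Delta + 1) * lambda_min (Dmx A a b t' k2).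
    by rewrite ler_pM2l.
  by rewrite /kfun /t'; lra.
apply: (le_trans kE); apply: (le_trans (kmax _ _ k2_ge0)).
have := lambda_min_le (mxcons 1 x) (Dmx_sym a b t l A_sym).
rewrite /kfun; move: (lambda_min _) => ell.
rewrite dotv_Dmx dotv_mxcons lagrangianE dotv_shift; lra.
Qed.

(** * Optimal values *)

(** The inner infimum may be [-oo], which is no obstacle; it is never [+oo],
    as the Lagrangian is finite at [0]. *)
Lemma dual_value_le (R : realType) (n : nat) (A : 'M[R]_n)
    (a b : 'cV[R]_n) (c Delta l1 l2 : R) (x : 'cV[R]_n) :
  dual_maximal A a b c Delta l1 l2 ->
  (dual_value A a b c Delta <= (lagrangian A a b c Delta l1 l2 x)%:E)%E.
Proof.
move=> maxL; apply: ge_ereal_sup => _ [[k1 k2] /= [_ k2_ge0] <-].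
set I := ereal_inf _.
have Ile y : (I <= (lagrangian A a b c Delta k1 k2 y)%:E)%E.
  by apply: ereal_inf_lbound; exists y.
case: I Ile => [m||] Ile; last exact: leNye.
  by rewrite lee_fin; apply: (maxL k1 k2 m k2_ge0) => y;
    rewrite -lee_fin; exact: Ile.
by have := Ile 0; rewrite leye_eq.
Qed.

Lemma primal_value_global_solution (R : realType) (n : nat) (A : 'M[R]_n)
    (a b : 'cV[R]_n) (c Delta : R) (x : 'cV[R]_n) :
  global_solution A a b c Delta x ->
  primal_value A a b c Delta = (objective A a x)%:E.
Proof.
move=> [xF xmin]; apply/le_anti/andP; split.
  by apply: ereal_inf_lbound; exists x.
by apply: le_ereal_inf_tmp => _ [y yF <-]; rewrite lee_fin xmin.
Qed.

Lemma global_solution_exists (R : realType) (n : nat) (A : 'M[R]_n)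
    (a b : 'cV[R]_n) (c Delta : R) :
  slater b c Delta -> exists x, global_solution A a b c Delta x.
Proof.
move=> [x0 [x0D x0c]].
have [|||x xF xmin] := @bounded_closed_EVT_min R n (objective A a)
    (feasible b c Delta) Delta _ _ _ (@quadratic_continuous R n A a).
- by exists x0; split; exact: ltW.
- rewrite (_ : feasible b c Delta = (fun x => dotv x x) @^-1` [set r | r <= Delta]
      `&` (fun x => dotv b x) @^-1` [set r | r <= c]); last first.
    by apply/seteqP; split => x; rewrite /feasible /= enorm_sqr.
  apply: closedI; apply: closed_comp (@closed_le _ _) => x _;
    apply: dotv_continuous => i; try exact: coord_continuous.
  exact: cst_continuous.
- by move=> x [+ _]; rewrite enorm_sqr.
by exists x.
Qed.

(** * Directions in an eigenspace *)

Lemma sphere_exit (R : realType) (n : nat) (Delta : R) (x w : 'cV[R]_n) :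
  dotv x x <= Delta -> w != 0 ->
  exists2 s, 0 <= s & dotv (x + s *: w) (x + s *: w) = Delta.
Proof.
move=> xD; rewrite -dotv_gt0 => w0.
have rho_ge0 : 0 <= dotv w w * (Delta - dotv x x).
  by rewrite mulr_ge0 ?subr_ge0 // ltW.
pose d := dotv x w ^+ 2 + dotv w w * (Delta - dotv x x).
have d_ge0 : 0 <= d by rewrite addr_ge0 ?sqr_ge0.
exists ((Num.sqrt d - dotv x w) / dotv w w).
  rewrite divr_ge0 ?(ltW w0) // subr_ge0 (le_trans (ler_norm _)) //.
  by rewrite -sqrtr_sqr ler_wsqrtr // lerDl.
have := sqr_sqrtr d_ge0; set r := Num.sqrt d => rE.
rewrite !dotv_lin [dotv w x]dotvC.
have -> : Delta = dotv x x + (r ^+ 2 - dotv x w ^+ 2) / dotv w w.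
  by rewrite rE /d; field; rewrite gt_eqF.
by field; rewrite gt_eqF.
Qed.

Lemma eigenspace_colP (R : realType) (n : nat) (A : 'M[R]_n) (m : R)
    (v : 'cV[R]_n) :
  A \is symmetricmx ->
  (v^T <= eigenspace A m)%MS = ((A - m%:M) *m v == 0).
Proof.
rewrite symmetricmx_tr => /eqP AT.
rewrite /eigenspace sub_kermx -{1}AT -(tr_scalar_mx n m) -linearB -trmx_mul.
by rewrite trmx_eq0 tr_scalar_mx.
Qed.

Lemma eigenspace_rank1_line (R : realType) (n : nat) (A : 'M[R]_n) (m : R)
    (h v : 'cV[R]_n) :
  A \is symmetricmx -> \rank (eigenspace A m) = 1%N ->
  h != 0 -> (A - m%:M) *m h = 0 -> (A - m%:M) *m v = 0 ->
  exists s, v = s *: h.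
Proof.
move=> A_sym rk h0 /eqP Ah /eqP Av.
have hE : (h^T <= eigenspace A m)%MS by rewrite eigenspace_colP.
have Eh : (eigenspace A m <= h^T)%MS.
  by rewrite -(mxrank_leqif_sup hE) rk rank_rV trmx_eq0 h0.
have /sub_rVP[s vE] : (v^T <= h^T)%MS.
  by apply: submx_trans Eh; rewrite eigenspace_colP.
by exists s; apply: trmx_inj; rewrite vE linearZ.
Qed.

(** Taking the inner product with [b] has rank at most one on the eigenspace,
    so an eigenspace meeting the hyperplane only at [0] is a line. *)
Lemma eigenspace_hyperplane (R : realType) (n : nat) (A : 'M[R]_n) (m : R)
    (b : 'cV[R]_n) :
  A \is symmetricmx -> eigenvalue A m ->
  (exists2 w : 'cV[R]_n, w != 0 & (A - m%:M) *m w = 0 /\ dotv b w = 0) \/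
  \rank (eigenspace A m) = 1%N.
Proof.
move=> A_sym; rewrite /eigenvalue -mxrank_eq0 => rk0.
have [/eqP cap0|/rowV0Pn[w]] := boolP ((eigenspace A m :&: kermx b)%MS == 0).
  right; apply/eqP; rewrite eqn_leq lt0n rk0 andbT.
  by rewrite -(mxrank_mul_ker _ b) cap0 mxrank0 addn0 rank_leq_col.
rewrite sub_capmx => /andP[wE /sub_kermxP wb] w0; left.
exists w^T; first by rewrite trmx_eq0.
split; first by apply/eqP; rewrite -eigenspace_colP // trmxK.
by rewrite dotvC /dotv trmxK wb mxE.
Qed.

(** * Duality for the extended trust region subproblem *)

Lemma lambda_min_le0 (R : realType) (n : nat) (A : 'M[R]_n) :
  A \is symmetricmx -> ~ posdef A -> (0 < n)%N /\ lambda_min A <= 0.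
Proof.
move=> A_sym A_npd.
have [x x0 xA] : exists2 x, x != 0 & dotv x (A *m x) <= 0.
  apply: contrapT => nex; apply: A_npd => x x0; rewrite ltNge; apply/negP => xA.
  by apply: nex; exists x.
split.
  by case: n A x x0 {A_sym A_npd xA} => // A x; rewrite (flatmx0 x) eqxx.
have := le_trans (lambda_min_le x A_sym) xA.
by rewrite pmulr_lle0 // dotv_gt0.
Qed.

Lemma stationary_solution (R : realType) (n : nat) (A : 'M[R]_n)
    (a b : 'cV[R]_n) (c Delta l1 l2 : R) (x : 'cV[R]_n) :
  A \is symmetricmx -> possemidef (A + l1%:M) -> 0 <= l1 -> 0 <= l2 ->
  (A + l1%:M) *m x = a - (l2 / 2) *: b ->
  dotv x x <= Delta -> dotv b x <= c ->
  l1 * (dotv x x - Delta) = 0 -> l2 * (dotv b x - c) = 0 ->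
  strong_duality A a b c Delta /\ global_solution A a b c Delta x.
Proof.
move=> A_sym Q_psd l1_ge0 l2_ge0 xE xD xc sl1 sl2.
apply: (@lagrangian_certificate _ _ _ _ _ _ _ l1 l2) => //.
  by split; rewrite // enorm_sqr.
move=> y; rewrite -[y](subrKC x) lagrangian_stationary //.
by rewrite lagrangian_slack // lerDl.
Qed.

(** Without a gap, a primal minimizer [x] is stationary and both constraints
    are active at it.  As the eigenspace is a line, [x] lies on the line
    through [x1] and [x2], which meets the sphere at no third point; but
    neither of the two is on the hyperplane. *)
Lemma duality_gap (R : realType) (n : nat) (A : 'M[R]_n)
    (a b : 'cV[R]_n) (c Delta l : R) :
  A \is symmetricmx -> slater b c Delta ->
  dual_maximal A a b c Delta (- lambda_min A) l ->
  duality_gap_conditions A a b c Delta l -> ~ strong_duality A a b c Delta.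
Proof.
move=> A_sym sl maxL [m0 rk l0 [x1 [x2 [x1E x2E x1D x2D bx]]]] sd.
have [x xsol] := global_solution_exists A a sl.
have pv := primal_value_global_solution xsol.
have [[xD xc] _] := xsol; rewrite enorm_sqr in xD.
have objL y : objective A a x <= lagrangian A a b c Delta (- lambda_min A) l y.
  by have := dual_value_le y maxL; rewrite -sd pv lee_fin.
have [xD_eq xc_eq] : dotv x x = Delta /\ dotv b x = c.
  have := objL x; rewrite /lagrangian enorm_sqr => obj.
  have p1 : 0 <= - lambda_min A * (Delta - dotv x x).
    by rewrite mulr_ge0 ?subr_ge0 // oppr_ge0 ltW.
  have p2 : 0 <= l * (c - dotv b x) by rewrite mulr_ge0 ?subr_ge0 // ltW.
  split; apply/eqP.
    have : - lambda_min A * (Delta - dotv x x) == 0 by rewrite eq_le p1 andbT; lra.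
    by rewrite mulf_eq0 oppr_eq0 lt_eqF //= subr_eq0 eq_sym.
  have : l * (c - dotv b x) == 0 by rewrite eq_le p2 andbT; lra.
  by rewrite mulf_eq0 gt_eqF //= subr_eq0 eq_sym.
have shiftE := sub_scalar_mx A (lambda_min A).
have Q_psd : possemidef (A + (- lambda_min A)%:M).
  by move=> u; rewrite dotv_shift mulNr subr_ge0 lambda_min_le.
have ker_h : (A - (lambda_min A)%:M) *m (x2 - x1) = 0.
  by rewrite mulmxBr x1E x2E subrr.
have ker_x : (A - (lambda_min A)%:M) *m (x - x1) = 0.
  rewrite shiftE; apply: (possemidef_ker (symmetricmx_shift _ A_sym) Q_psd).
  apply/eqP; rewrite eq_le Q_psd andbT.
  have := objL x1.
  rewrite -(@lagrangian_slack _ _ A a b c Delta (- lambda_min A) l);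
    rewrite ?xD_eq ?xc_eq ?subrr ?mulr0 //.
  rewrite -{1}(subrKC x1 x) lagrangian_stationary -?shiftE // shiftE.
  by rewrite gerDl.
have h0 : x2 - x1 != 0.
  rewrite subr_eq0; apply: contraTneq bx => ->.
  by rewrite -leNgt -expr2 sqr_ge0.
have [s xE] := eigenspace_rank1_line A_sym rk h0 ker_h ker_x.
have {}xE : x = x1 + s *: (x2 - x1) by rewrite -xE subrKC.
have hh : 2 * dotv x1 (x2 - x1) + dotv (x2 - x1) (x2 - x1) = 0.
  by rewrite !dotv_lin [dotv x2 x1]dotvC x1D x2D; ring.
have : s * (s - 1) * dotv (x2 - x1) (x2 - x1) = 0.
  have : dotv x x = dotv x1 x1 + 2 * s * dotv x1 (x2 - x1)
      + s ^+ 2 * dotv (x2 - x1) (x2 - x1).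
    by rewrite xE; move: (x2 - x1) => h; rewrite !dotv_lin [dotv h x1]dotvC; ring.
  rewrite xD_eq x1D; move: hh; move: (dotv _ _) (dotv _ _) => p q; nra.
move/eqP; rewrite !mulf_eq0 dotv_eq0 (negPf h0) orbF subr_eq0.
move=> /orP[] /eqP s_val; move: xE; rewrite s_val ?scale0r ?addr0 ?scale1r ?subrKC.
  by move=> xx1; move: bx; rewrite -xx1 xc_eq subrr mul0r ltxx.
by move=> xx2; move: bx; rewrite -xx2 xc_eq subrr mulr0 ltxx.
Qed.

(** Starting from a feasible stationary point [x], moves along the eigenspace
    keep stationarity, so it suffices to reach the sphere without disturbing
    the linear constraint and its slackness.  This fails only if the two exit
    points of a one-dimensional eigenspace lie strictly on opposite sides of
    the hyperplane on which [x] lies. *)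
Lemma no_duality_gap (R : realType) (n : nat) (A : 'M[R]_n)
    (a b : 'cV[R]_n) (c Delta l : R) (x0 : 'cV[R]_n) :
  A \is symmetricmx -> ~ posdef A ->
  dual_maximal A a b c Delta (- lambda_min A) l -> 0 <= l ->
  (A - (lambda_min A)%:M) *m x0 = a - (l / 2) *: b ->
  ~ duality_gap_conditions A a b c Delta l ->
  strong_duality A a b c Delta /\
  exists z : 'cV[R]_n, (A - (lambda_min A)%:M) *m z = 0 /\
    global_solution A a b c Delta (x0 + z).
Proof.
move=> A_sym A_npd maxL l_ge0 x0E nogap.
have [n0 m_le0] := lambda_min_le0 A_sym A_npd.
have shiftE := sub_scalar_mx A (lambda_min A).
have Q_psd : possemidef (A + (- lambda_min A)%:M).
  by move=> u; rewrite dotv_shift mulNr subr_ge0 lambda_min_le.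
have [x [xE xD xc xsl]] : exists x,
    [/\ (A - (lambda_min A)%:M) *m x = a - (l / 2) *: b,
    dotv x x <= Delta, dotv b x <= c & l * (dotv b x - c) = 0].
  rewrite shiftE in x0E *; exact: dual_maximal_KKT x0E.
suff [y [yE yD yc ysl]] : exists y,
    [/\ (A - (lambda_min A)%:M) *m y = a - (l / 2) *: b,
    dotv y y <= Delta /\ - lambda_min A * (dotv y y - Delta) = 0,
    dotv b y <= c & l * (dotv b y - c) = 0].
  have [sd gs] : strong_duality A a b c Delta /\ global_solution A a b c Delta y.
    apply: stationary_solution Q_psd _ l_ge0 _ yD.1 yc yD.2 ysl => //.
      by rewrite oppr_ge0.
    by rewrite -shiftE.
  split => //; exists (y - x0); rewrite mulmxBr yE x0E subrr; split => //.
  by rewrite subrKC.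
have [m_eq0|m_neq0] := eqVneq (lambda_min A) 0.
  by exists x; split => //; split; rewrite // m_eq0 oppr0 mul0r.
have m_lt0 : lambda_min A < 0 by rewrite lt_def eq_sym m_neq0.
suff [y [yE yD yc ysl]] : exists y,
    [/\ (A - (lambda_min A)%:M) *m y = a - (l / 2) *: b,
    dotv y y = Delta, dotv b y <= c & l * (dotv b y - c) = 0].
  by exists y; rewrite yD subrr mulr0.
have move_ker w s : (A - (lambda_min A)%:M) *m w = 0 ->
    (A - (lambda_min A)%:M) *m (x + s *: w) = a - (l / 2) *: b.
  by move=> Aw; rewrite mulmxDr xE -scalemxAr Aw scaler0 addr0.
have bline w t : dotv b (x + t *: w) = dotv b x + t * dotv b w by rewrite !dotv_lin.
have [m_eig _] := lambda_min_rayleigh n0 A_sym.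
have [[w w0 [Aw bw]]|rk] := eigenspace_hyperplane b A_sym m_eig.
  have [s _ sD] := sphere_exit xD w0.
  by exists (x + s *: w); rewrite move_ker // bline bw mulr0 addr0.
have [w Aw w0] : exists2 w : 'cV[R]_n, (A - (lambda_min A)%:M) *m w = 0 & w != 0.
  have /(eigenvalue_colP _ A_sym)[w Aw w0] := m_eig; exists w => //.
  by rewrite mulmxBl mul_scalar_mx Aw subrr.
have Nw0 : - w != 0 by rewrite oppr_eq0.
have [s s_ge0 sD] := sphere_exit xD w0.
have [r r_ge0 rD] := sphere_exit xD Nw0.
rewrite scalerN -scaleNr in rD.
have [l_eq0|l_neq0] := eqVneq l 0.
  have [bw|bw] := leP (dotv b w) 0.
    exists (x + s *: w); split; rewrite ?move_ker //; last by rewrite l_eq0 mul0r.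
    by rewrite bline; nra.
  exists (x + (- r) *: w); split; rewrite ?move_ker //; last by rewrite l_eq0 mul0r.
  by rewrite bline; nra.
have l_gt0 : 0 < l by rewrite lt_def l_neq0.
have bx : dotv b x = c.
  by move/eqP: xsl; rewrite mulf_eq0 (negPf l_neq0) subr_eq0 => /eqP.
have [zero|nonzero] := eqVneq (s * r * dotv b w) 0.
  have [t [tD tb]] : exists t,
      dotv (x + t *: w) (x + t *: w) = Delta /\ t * dotv b w = 0.
    move/eqP: zero; rewrite !mulf_eq0 -orbA => /or3P[]/eqP z.
    - by exists s; rewrite sD z mul0r.
    - by exists (- r); rewrite rD z oppr0 mul0r.
    - by exists s; rewrite sD z mulr0.
  by exists (x + t *: w); rewrite move_ker // bline tb addr0.
case: nogap; split => //; exists (x + s *: w), (x + (- r) *: w).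
rewrite !move_ker // !bline bx; split => //.
have -> : (c + s * dotv b w - c) * (c + - r * dotv b w - c) =
  - (s * r * dotv b w ^+ 2) by ring.
rewrite oppr_lt0; move: nonzero.
rewrite !mulf_eq0 !negb_or => /andP[/andP[s0 r0] bw].
by rewrite mulr_gt0 ?exprn_even_gt0 // mulr_gt0 // lt_def ?s0 ?r0.
Qed.

Unset Implicit Arguments.
Local Close Scope classical_set_scope.

Theorem theorem4 (R : realType) (n : nat) (A : 'M[R]_n) (a b : 'cV[R]_n)
  (c Delta : R)
  (A_sym : A \is symmetricmx)
  (A_npd : ~ posdef A)
  (Delta_gt0 : 0 < Delta)
  (slater_cond : slater b c Delta)
  (ts ls : R)
  (opt : k_optimal A a b c Delta ts ls) :
  (lambda_min (Dmx A a b ts ls) < lambda_min A ->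
   forall (y0 : R) (z : 'cV[R]_n),
     normalized_eigenvector (Dmx A a b ts ls) (lambda_min (Dmx A a b ts ls))
       (mxcons y0 z) ->
     [/\ strong_duality A a b c Delta,
         y0 != 0 &
         global_solution A a b c Delta (y0^-1 *: z)])
  /\
  (lambda_min (Dmx A a b ts ls) = lambda_min A ->
   forall (y0 : R) (z0 : 'cV[R]_n),
     normalized_eigenvector (Dmx A a b ts ls) (lambda_min (Dmx A a b ts ls))
       (mxcons y0 z0) ->
     y0 != 0 ->
     (duality_gap_conditions A a b c Delta ls ->
      ~ strong_duality A a b c Delta)
     /\
     (~ duality_gap_conditions A a b c Delta ls ->
      strong_duality A a b c Delta /\
      exists z : 'cV[R]_n,
        (A - (lambda_min A)%:M) *m z = 0 /\
        global_solution A a b c Delta (y0^-1 *: z0 + z))).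
Proof.
have maxL := k_optimal_dual_maximal A_sym Delta_gt0 opt.
have [ls_ge0 _] := opt; have [_ m_le0] := lambda_min_le0 A_sym A_npd.
move: (lambda_min (Dmx A a b ts ls)) maxL => ell maxL.
split=> [ell_lt y0 z /normalized_eigenvector_mxcons[zE y1]|ell_eq y0 z0].
  have coercive u :
      (lambda_min A - ell) * dotv u u <= dotv u ((A + (- ell)%:M) *m u).
    by rewrite dotv_shift; have := lambda_min_le u A_sym; lra.
  have gap0 : 0 < lambda_min A - ell by rewrite subr_gt0.
  have Q_psd : possemidef (A + (- ell)%:M).
    move=> u; apply: le_trans (coercive u).
    by rewrite mulr_ge0 ?dotv_ge0 // ltW.
  have Q_inj (u : 'cV[R]_n) : (A + (- ell)%:M) *m u = 0 -> u = 0.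
    move=> Qu; have := coercive u; rewrite Qu dotv0r pmulr_rle0 // => u0.
    by apply/eqP; rewrite -dotv_eq0 eq_le u0 dotv_ge0.
  have y0_neq0 : y0 != 0.
    apply/eqP => y0_eq0; move: zE y1; rewrite y0_eq0 scale0r => /Q_inj ->.
    by rewrite dotv0l expr0n addr0 => /eqP; rewrite eq_sym oner_eq0.
  have xE : (A + (- ell)%:M) *m (y0^-1 *: z) = a - (ls / 2) *: b.
    by rewrite -scalemxAr zE scalerA mulVf // scale1r.
  have [x [xE' xD xc xsl]] := dual_maximal_KKT A_sym Q_psd maxL ls_ge0 xE.
  have xx : x = y0^-1 *: z.
    by apply/eqP; rewrite -subr_eq0; apply/eqP/Q_inj; rewrite mulmxBr xE xE' subrr.
  have Dx := dual_maximal_boundary A_sym gap0 coercive maxL ls_ge0 xE'.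
  have [sd gs] : strong_duality A a b c Delta /\ global_solution A a b c Delta x.
    have ell_le0 : 0 <= - ell by lra.
    have x_sphere : dotv x x = Delta by apply/le_anti/andP.
    apply: (stationary_solution A_sym Q_psd ell_le0 ls_ge0 xE' xD xc _ xsl).
    by rewrite x_sphere subrr mulr0.
  by rewrite -xx.
rewrite {}ell_eq in maxL * => /normalized_eigenvector_mxcons[z0E _] y0_neq0.
split; first exact: duality_gap.
apply: no_duality_gap => //.
by rewrite -scalemxAr sub_scalar_mx z0E scalerA mulVf // scale1r.
Qed.
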